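(* Let $\mathcal{A}$ be a finite dimensional C$^*$-algebra and let $x\in\mathcal{A}$, with distinct singular values $\sigma_1(x)>\dots>\sigma_{n_0}(x)$ and associated partial isometries $e_1,\dots,e_{n_0}$. Then for every $\varepsilon>0$ there exists $\delta>0$ (smaller than one half of the minimal distance between distinct elements of $\{\sigma_1(x),\dots,\sigma_{n_0}(x)\}\cup\{0\}$) such that for every $y\in\mathcal{A}$ with $\|y-x\|\le\delta$ one has $\|e_i-f_i\|\le\varepsilon$ for each $i\in\{1,\dots,n_0\}$ with $\sigma_i(x)>0$, where $f_1,\dots,f_{n_0}$ are the partial isometries associated with $y$ (and $x$, $\delta$) as defined in the context.
   Context: For $x$ in a finite dimensional C$^*$-algebra $\mathcal{A}$, $|x|=(x^*x)^{1/2}$, and there is a unitary $u\in\mathcal{A}$ with $x=u|x|$. The singular values of $x$ are the eigenvalues of $|x|$; $\sigma_1(x)>\dots>\sigma_{n_0}(x)$ denote them in decreasing order, not counting multiplicity. Let $p_i$ be the spectral projection of $|x|$ associated with the eigenvalue $\sigma_i(x)$ and put $e_i=up_i$, so that $x=\sum_{i=1}^{n_0}\sigma_i(x)e_i$. Fix $\delta>0$ smaller than one half of the minimal distance between distinct elements of $\{\sigma_1(x),\dots,\sigma_{n_0}(x)\}\cup\{0\}$ (any $\delta>0$ if this set is $\{0\}$). For $y\in\mathcal{A}$ with $\|y-x\|\le\delta$, let $v\in\mathcal{A}$ be a unitary with $y=v|y|$, let $q_i$ be the spectral projection of $|y|$ associated with the set $[\sigma_i(x)-\delta,\sigma_i(x)+\delta]$,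 and put $f_i=vq_i$ ($i=1,\dots,n_0$). *)

(* Defs.v *)
From HB Require Import structures.
From mathcomp Require Import all_boot all_order all_algebra all_field.
From mathcomp Require Import finmap.
From mathcomp Require Import complex.
From mathcomp Require Import all_classical all_reals all_analysis.

Set Implicit Arguments.
Unset Strict Implicit.
Unset Printing Implicit Defensive.

Import Order.TTheory GRing.Theory Num.Theory.
Import VectorInternalTheory.
Local Open Scope classical_set_scope.
Local Open Scope complex_scope.
Local Open Scope ring_scope.

(* The C*-norm is part of the structure; completeness is not stated since it is
   automatic in finite dimension.  A finite dimensional C*-algebra has a unit;
   as [falgType] is nontrivial, the zero algebra is excluded. *)
HB.mixin Record Falgebra_isCstar (R : realType) A
    of Falgebra R[i] A := {
  star : A -> A;
  starK : involutive star;
  starD : {morph star : a b / a + b >-> a + b};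
  starZ : forall (z : R[i]) (a : A), star (z *: a) = z^* *: star a;
  starM : forall a b : A, star (a * b) = star b * star a;
  cnorm : A -> R;
  cnorm0_eq0 : forall a : A, cnorm a = 0 -> a = 0;
  cnormD_le : forall a b : A, cnorm (a + b) <= cnorm a + cnorm b;
  cnormZ : forall (z : R[i]) (a : A),
    cnorm (z *: a) = ComplexField.Normc.normc z * cnorm a;
  cnormM_le : forall a b : A, cnorm (a * b) <= cnorm a * cnorm b;
  cnorm_star : forall a : A, cnorm (star a * a) = cnorm a ^+ 2
}.

#[short(type="fdCstarAlgType")]
HB.structure Definition FdCstarAlgebra (R : realType) :=
  { A of Falgebra R[i] A & Falgebra_isCstar R A }.

Definition unitary (R : realType) (A : fdCstarAlgType R) (u : A) : Prop :=
  star u * u = 1 /\ u * star u = 1.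

Definition spectrum (R : realType) (A : fdCstarAlgType R) (a : A) : set R[i] :=
  [set z | a - z%:A \isn't a GRing.unit].

Lemma spectrum_finite (R : realType) (A : fdCstarAlgType R) (a : A) :
  finite_set (spectrum a).
Proof.
pose p := char_poly (f2mx (amull a)).
have p0 : p != 0 by rewrite monic_neq0 // char_poly_monic.
have [r pr] := closed_field_poly_normal p.
apply: (@sub_finite_set _ _ [set` r]); last exact: finite_seq.
move=> z; rewrite /spectrum /= => nu.
suff: root p z.
  by rewrite pr rootZ ?lead_coef_eq0 // root_prod_XsubC.
rewrite -eigenvalue_root_char.
have : lker (amull (a - z%:A)) != 0%VS.
  apply: contraNN nu => k0; set c := a - _ in k0 *.
  have cb : c * ((amull c)^-1%VF 1) = 1.
    by have := lker0_lfunVK k0 1; rewrite lfunE.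
  apply/unitrP; exists ((amull c)^-1%VF 1); split => //.
  have /lker0P ci := k0; apply: ci.
  by rewrite !lfunE /= mulrA cb mul1r mulr1.
move=> kn0; set w := vpick (lker (amull (a - z%:A))).
have w0 : w != 0 by rewrite vpick0.
have : w \in lker (amull (a - z%:A)) by exact: memv_pick.
rewrite memv_ker lfunE /= mulrBl subr_eq0 -scalerAl mul1r => /eqP aw.
apply/eigenvalueP; exists (v2r w).
  have : amull a w = z *: w by rewrite lfunE.
  by rewrite unlock /= => /(congr1 v2r); rewrite r2vK linearZ.
by apply: contraNneq w0 => vw0; rewrite -[w]v2rK vw0 linear0.
Qed.

(* The Lagrange polynomial taking the value [f z] at each [z] in [s]. *)
Definition interpolation (K : fieldType) (f : K -> K) (s : seq K) : {poly K} :=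
  \sum_(z <- s) f z *: \prod_(w <- s | w != z) ((z - w)^-1 *: ('X - w%:P)).

Lemma interpolationE (K : fieldType) (f : K -> K) (s : seq K) (z : K) :
  uniq s -> z \in s -> (interpolation f s).[z] = f z.
Proof.
move=> us zs; rewrite /interpolation horner_sum (bigD1_seq z) //= hornerZ.
rewrite horner_prod big1 ?mulr1 => [|w wz]; last first.
  by rewrite hornerZ hornerXsubC mulVf // subr_eq0 eq_sym.
rewrite big1 ?addr0 // => w wz; rewrite hornerZ horner_prod.
rewrite (big_rem z zs) /= eq_sym wz hornerZ hornerXsubC.
by rewrite subrr mulr0 mul0r mulr0.
Qed.

(* Functional calculus f(a) of a normal element [a]: the value at [a] of any
   polynomial agreeing with [f] on the (finite) spectrum of [a]. *)
Definition fcalc (R : realType) (A : fdCstarAlgType R) (f : R[i] -> R[i])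
    (a : A) : A :=
  horner_alg a (interpolation f (fset_set (spectrum a))).

Definition absolute (R : realType) (A : fdCstarAlgType R) (x : A) : A :=
  fcalc sqrtC (star x * x).

Definition spectral_proj (R : realType) (A : fdCstarAlgType R) (a : A)
    (S : set R) : A :=
  fcalc \1_((real_complex R) @` S) a.

(* The spectrum of |x| is a set of nonnegative reals; [singvals x] lists it in
   decreasing order, without repetition. *)
Definition singvals (R : realType) (A : fdCstarAlgType R) (x : A) : seq R :=
  sort >=%R (fset_set [set s : R | spectrum (absolute x) s%:C]).

(* The partial isometry e_(i+1) of [x], for a polar decomposition x = u|x|. *)
Definition partial_isom (R : realType) (A : fdCstarAlgType R) (x u : A)
    (i : nat) : A :=
  u * spectral_proj (absolute x) [set (singvals x)`_i].

(* The partial isometry f_(i+1) of [y], for a polar decomposition y = v|y|; it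
   depends on [x] and [delta] through the interval around the singular value. *)
Definition perturbed_partial_isom (R : realType) (A : fdCstarAlgType R)
    (x : A) (delta : R) (y v : A) (i : nat) : A :=
  let s := (singvals x)`_i in
  v * spectral_proj (absolute y) `[s - delta, s + delta].

(* Vacuous when 0 is the only possible singular value. *)
Definition below_half_gap (R : realType) (A : fdCstarAlgType R) (x : A)
    (delta : R) : Prop :=
  forall s t : R, s \in 0 :: singvals x -> t \in 0 :: singvals x -> s != t ->
    delta < `|s - t| / 2.

Lemma mem_singvals (R : realType) (A : fdCstarAlgType R) (x : A) (s : R) :
  (s \in singvals x) = (s%:C \in spectrum (absolute x)).
Proof.
rewrite mem_sort in_fset_set; first by apply/idP/idP; rewrite !inE.
apply: (@finite_preimage _ _ (spectrum (absolute x)) (real_complex R)).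
  by move=> u v _ _ [].
exact: spectrum_finite.
Qed.

Lemma singvals_sorted (R : realType) (A : fdCstarAlgType R) (x : A) :
  sorted >%R (singvals x).
Proof.
have := @lt_sorted_uniq_le _ R^d (singvals x).
rewrite sort_uniq fset_uniq /= => ->.
by apply: sort_sorted => s t; exact: ge_total.
Qed.

(* Main.v *)
(* By functional calculus e_i = x g(x^* x), where g is a polynomial with
   g(s^2) = 1/s at s = sigma_i and g(t^2) = 0 at the other singular values t
   of x.  As y tends to x, y g(y^* y) tends to x g(x^* x), and f_i differs from
   y g(y^* y) = v |y| g(|y|^2) by the values of t g(t^2) - 1_[sigma_i - delta,
   sigma_i + delta] on the spectrum of |y|, which are O(delta) once every
   singular value of y is known to lie within delta of a singular value of x.

   This last point needs the constant 1 exactly.  It comes from a Hilbert space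
   norm on the algebra: the trace tau of left multiplication satisfies
   tau(a^* a) > 0 for nonzero a, so that x and y act on the Hilbert space
   (A, tau(a^* b)), where singular values can be compared by the parallelogram
   law. *)
Require Import Defs.
From mathcomp Require Import all_boot all_order all_algebra all_field.
From mathcomp Require Import finmap complex.
From mathcomp Require Import all_classical all_reals all_analysis.
From mathcomp Require Import lra.

Set Implicit Arguments.
Unset Strict Implicit.
Unset Printing Implicit Defensive.

Import Order.TTheory GRing.Theory Num.Theory.
Import VectorInternalTheory.
Local Open Scope classical_set_scope.
Local Open Scope complex_scope.
Local Open Scope ring_scope.

(** * Spectrum and polynomials of an element *)

(** In finite dimension an injective left multiplication is onto and yields an inverse. So a
    non-invertible [a - z%:A] kills some nonzero [w]: spectral points have eigenvectors inside the
    algebra itself. *)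
Lemma spectrumP (R : realType) (A : fdCstarAlgType R) (a : A) (z : R[i]) :
  spectrum a z <-> exists2 w : A, w != 0 & a * w = z *: w.
Proof.
split=> [nu|[w w0 aw]]; last first.
  rewrite /spectrum /=; apply: contra_neqN w0 => u.
  by apply: (mulrI u); rewrite mulr0 mulrBl aw -scalerAl mul1r subrr.
have : lker (amull (a - z%:A)) != 0%VS.
  apply: contraNN nu => k0; set c := a - _ in k0 *.
  have cb : c * ((amull c)^-1%VF 1) = 1.
    by have := lker0_lfunVK k0 1; rewrite lfunE.
  apply/unitrP; exists ((amull c)^-1%VF 1); split => //.
  have /lker0P ci := k0; apply: ci.
  by rewrite !lfunE /= mulrA cb mul1r mulr1.
move=> kn0; exists (vpick (lker (amull (a - z%:A)))); first by rewrite vpick0.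
have := memv_pick (lker (amull (a - z%:A))).
by rewrite memv_ker lfunE /= mulrBl subr_eq0 -scalerAl mul1r => /eqP.
Qed.

Lemma horner_alg_eigen (K : fieldType) (A : algType K) (a w : A) (z : K)
    (p : {poly K}) :
  a * w = z *: w -> horner_alg a p * w = p.[z] *: w.
Proof.
move=> aw; elim/poly_ind: p => [|p c IH].
  by rewrite rmorph0 horner0 mul0r scale0r.
rewrite rmorphD rmorphM /= horner_algX horner_algC mulrDl -mulrA aw -scalerAr IH.
by rewrite scalerA -scalerAl mul1r -scalerDl hornerD hornerMX hornerC mulrC.
Qed.

Lemma horner_alg_comm (K : fieldType) (A : algType K) (a : A) (p : {poly K}) :
  horner_alg a p * a = a * horner_alg a p.
Proof.
by have := congr1 (horner_alg a) (mulrC p 'X); rewrite !rmorphM /= horner_algX.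
Qed.

(** One more power of [a] than the dimension gives a linear dependence. The size bound later limits
    the number of spectral points. *)
Lemma annihilating_poly (K : fieldType) (A : falgType K) (a : A) :
  exists p : {poly K},
    [/\ p != 0, (size p <= (\dim {:A}).+1)%N & horner_alg a p = 0].
Proof.
pose d := \dim {:A}; pose X := [tuple a ^+ i | i < d.+1].
have nfree : ~~ free X.
  apply/negP; rewrite /free => /eqP h.
  have := dimvS (subvf <<X>>); rewrite h size_tuple /d; by rewrite ltnn.
have [k [k0 [i ki]]] : exists k : 'I_d.+1 -> K,
    \sum_(i < d.+1) k i *: X`_i = 0 /\ exists i, k i != 0.
  apply: contrapT => H; move/negP: nfree; apply; apply/freeP => k hk i.
  by apply: contrapT => /eqP ki; apply: H; exists k; split => //; exists i.
(* [insub] turns coefficients indexed by ['I_d.+1] into coefficients at natural indices; its default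
   0 is never reached below [d.+1]. *)
exists (\poly_(i < d.+1) if insub i is Some j then k j else 0); split.
- apply/eqP => /(congr1 (fun p : {poly K} => p`_i)).
  by rewrite coef_poly ltn_ord valK coef0 => /eqP; rewrite (negbTE ki).
- exact: size_poly.
- rewrite poly_def rmorph_sum -[RHS]k0; apply: eq_bigr => j _.
  have -> : X`_j = a ^+ j by rewrite -tnth_nth tnth_mktuple.
  rewrite valK -mul_polyC rmorphM rmorphXn /= horner_algX horner_algC.
  by rewrite -scalerAl mul1r.
Qed.

(** * Norm and involution *)

Lemma cnorm0 (R : realType) (A : fdCstarAlgType R) : cnorm (0 : A) = 0.
Proof. by rewrite -(scale0r (0 : A)) cnormZ ComplexField.Normc.normc0 mul0r. Qed.

Lemma cnormN (R : realType) (A : fdCstarAlgType R) (a : A) :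
  cnorm (- a) = cnorm a.
Proof.
rewrite -scaleN1r cnormZ /ComplexField.Normc.normc /= oppr0 expr0n addr0.
by rewrite sqrrN expr1n sqrtr1 mul1r.
Qed.

Lemma cnorm_ge0 (R : realType) (A : fdCstarAlgType R) (a : A) : 0 <= cnorm a.
Proof.
have := cnormD_le a (- a); rewrite subrr cnorm0 cnormN; lra.
Qed.

Lemma cnorm_sum_le (R : realType) (A : fdCstarAlgType R) (I : Type)
    (r : seq I) (F : I -> A) :
  cnorm (\sum_(i <- r) F i) <= \sum_(i <- r) cnorm (F i).
Proof.
elim/big_ind2: _ => [|a s b t hs ht|//]; first by rewrite cnorm0.
by rewrite (le_trans (cnormD_le _ _)) // lerD.
Qed.

Lemma star0 (R : realType) (A : fdCstarAlgType R) : star (0 : A) = 0.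
Proof. by apply: (addrI (star (0 : A))); rewrite -starD !addr0. Qed.

Lemma starN (R : realType) (A : fdCstarAlgType R) (a : A) : star (- a) = - star a.
Proof. by apply/eqP; rewrite -addr_eq0 -starD addNr star0. Qed.

Lemma starB (R : realType) (A : fdCstarAlgType R) (a b : A) :
  star (a - b) = star a - star b.
Proof. by rewrite starD starN. Qed.

Lemma star1 (R : realType) (A : fdCstarAlgType R) : star (1 : A) = 1.
Proof. by rewrite -[LHS]mul1r -{1}(starK (1 : A)) -starM mul1r starK. Qed.

Lemma star_horner (R : realType) (A : fdCstarAlgType R) (a : A) (p : {poly R[i]}) :
  star (horner_alg a p) = horner_alg (star a) (map_poly Num.conj p).
Proof.
elim/poly_ind: p => [|p c IH]; first by rewrite !rmorph0 star0.
rewrite !(rmorphD, rmorphM) /= map_polyX map_polyC /= !horner_algX !horner_algC.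
by rewrite starD starM starZ star1 IH horner_alg_comm.
Qed.

Lemma star_mul_eq0 (R : realType) (A : fdCstarAlgType R) (a : A) :
  star a * a = 0 -> a = 0.
Proof.
move=> h; apply: cnorm0_eq0; apply/eqP; rewrite -sqrf_eq0.
by rewrite -cnorm_star h cnorm0.
Qed.

Lemma cnorm_starE (R : realType) (A : fdCstarAlgType R) (a : A) :
  cnorm (star a) = cnorm a.
Proof.
have h (b : A) : cnorm b <= cnorm (star b).
  have [->|b0] := eqVneq (cnorm b) 0; first exact: cnorm_ge0.
  have bp : 0 < cnorm b by rewrite lt_def b0 cnorm_ge0.
  by rewrite -(ler_pM2r bp) -expr2 -cnorm_star cnormM_le.
by apply/eqP; rewrite eq_le h -{2}(starK a) h.
Qed.

Lemma cnorm_idem_le1 (R : realType) (A : fdCstarAlgType R) (a : A) :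
  star a = a -> a * a = a -> cnorm a <= 1.
Proof.
move=> sa aa; have := cnorm_star a; rewrite sa aa => h.
by have := cnorm_ge0 a; nra.
Qed.

Lemma cnorm1 (R : realType) (A : fdCstarAlgType R) : cnorm (1 : A) = 1.
Proof.
have := cnorm_star (1 : A); rewrite star1 mul1r => h.
have : cnorm (1 : A) != 0 by apply/eqP => /cnorm0_eq0/eqP; rewrite oner_eq0.
by move=> h1; apply: (mulfI h1); rewrite mulr1 -expr2.
Qed.

Lemma cnorm_unitary (R : realType) (A : fdCstarAlgType R) (u : A) :
  unitary u -> cnorm u = 1.
Proof.
move=> [uu _]; have := cnorm_star u; rewrite uu cnorm1 => /esym/eqP.
by rewrite sqrf_eq1 => /orP[/eqP //|/eqP h]; have := cnorm_ge0 u; lra.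
Qed.

(** * Spectral theorem and functional calculus for self-adjoint elements *)

(** For self-adjoint [b], [b ^+ 2 = 0] forces [b = 0] by the C*-identity, so a vanishing power with
    exponent [2 ^ n] can be halved down to exponent 1. *)
Lemma selfadj_nilp (R : realType) (A : fdCstarAlgType R) (a : A) (n : nat) :
  star a = a -> a ^+ n = 0 -> a = 0.
Proof.
move=> sa an; have : a ^+ (2 ^ n) = 0.
  by rewrite -(subnK (ltnW (ltn_expl n (ltnSn 1)))) exprD an mulr0.
elim: n {an} => [//|n IH] h; apply: IH; apply: star_mul_eq0.
have -> : star (a ^+ (2 ^ n)) = a ^+ (2 ^ n).
  by elim: (2 ^ n)%N => [|m IH]; rewrite ?star1 // {1}exprS starM IH sa -exprSr.
by rewrite -exprD addnn -mul2n -expnS.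
Qed.

(** For an eigenvector [w], computing [star w * a * w] from either side gives [star w * w] times [z]
    and times its conjugate. *)
Lemma selfadj_spectrum_real (R : realType) (A : fdCstarAlgType R) (a : A)
    (z : R[i]) :
  star a = a -> spectrum a z -> z^* = z.
Proof.
move=> sa /spectrumP[w w0 aw]; apply/eqP; rewrite -subr_eq0; apply: contraNT w0 => h.
apply/eqP/star_mul_eq0/eqP.
have : (z^* - z) *: (star w * w) = 0.
  by rewrite scalerBl scalerAl -starZ -aw starM sa -mulrA aw -scalerAr subrr.
by move/eqP; rewrite scaler_eq0 (negbTE h).
Qed.

Lemma fset_spectrumP (R : realType) (A : fdCstarAlgType R) (a : A) (z : R[i]) :
  reflect (spectrum a z) (z \in fset_set (spectrum a)).
Proof.
rewrite in_fset_set; last exact: spectrum_finite.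
by apply: (iffP idP); rewrite inE.
Qed.

(** An annihilating polynomial splits into linear factors. Those with a root outside the spectrum
    are invertible at [a] and cancel; the others divide [m], so a power of [m] kills [a]. The
    spectrum being real, [m] at [a] is self-adjoint, and a self-adjoint nilpotent is zero. *)
Lemma selfadj_prod_spectrum (R : realType) (A : fdCstarAlgType R) (a : A) :
  star a = a ->
  horner_alg a (\prod_(z <- fset_set (spectrum a)) ('X - z%:P)) = 0.
Proof.
move=> sa; set m := \prod_(z <- _) _.
have [p [p0 _ pa]] := annihilating_poly a.
have [r pr] := closed_field_poly_normal p.
have mr : map_poly Num.conj m = m.
  rewrite rmorph_prod; apply: eq_big_seq => z /fset_spectrumP.
  move=> /(selfadj_spectrum_real sa) zr.
  by rewrite rmorphB /= map_polyX map_polyC /=; rewrite zr.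
suff : horner_alg a (m ^+ size r) = 0.
  by rewrite rmorphXn /=; apply: selfadj_nilp; rewrite star_horner sa mr.
have : horner_alg a (\prod_(z <- r) ('X - z%:P)) = 0.
  move: pa; rewrite pr -mul_polyC rmorphM /= horner_algC -scalerAl mul1r.
  by move/eqP; rewrite scaler_eq0 lead_coef_eq0 (negbTE p0) => /eqP.
(* The right factor [c] absorbs the linear factors of spectral roots in the induction over [r]. *)
suff key c : horner_alg a (\prod_(z <- r) ('X - z%:P)) * c = 0 ->
    horner_alg a (m ^+ size r) * c = 0.
  by move=> h; rewrite -[LHS]mulr1 key // h mul0r.
elim: r {pr} c => [|z r IH] c /=; first by rewrite big_nil expr0.
rewrite big_cons.
have [zs|zs] := boolP (z \in fset_set (spectrum a)).
  pose q := \prod_(y <- rem z (fset_set (spectrum a))) ('X - y%:P).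
  have mq : m = q * ('X - z%:P) by rewrite /m (big_rem z) //= mulrC.
  rewrite exprS {1}mq -mulrA [X in q * X]mulrC [('X - z%:P) * _]mulrC.
  rewrite !rmorphM /= -!mulrA => h.
  by rewrite (IH (horner_alg a ('X - z%:P) * c)) ?mulr0.
have u : a - z%:A \is a GRing.unit.
  by apply/negPn/negP => nu; move/fset_spectrumP: zs; apply.
rewrite exprS !rmorphM /= -!mulrA => h; rewrite IH ?mulr0 //.
apply: (mulrI u); rewrite mulr0 -[RHS]h; congr (_ * _).
by rewrite rmorphB /= horner_algX horner_algC.
Qed.

(** The difference is a multiple of the polynomial with the spectral points as simple roots, which
    kills [a]. Hence identities of the functional calculus can be checked pointwise on the
    spectrum. *)
Lemma eq_horner_spectrum (R : realType) (A : fdCstarAlgType R) (a : A)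
    (p q : {poly R[i]}) :
  star a = a -> (forall z, spectrum a z -> p.[z] = q.[z]) ->
  horner_alg a p = horner_alg a q.
Proof.
move=> sa pq; apply/eqP; rewrite -subr_eq0 -rmorphB /=.
have /dvdpP[d ->] : \prod_(z <- fset_set (spectrum a)) ('X - z%:P) %| p - q.
  apply: uniq_roots_dvdp; last by rewrite uniq_rootsE fset_uniq.
  apply/allP => z /fset_spectrumP /pq h.
  by rewrite /root hornerD hornerN h subrr.
by rewrite rmorphM /= selfadj_prod_spectrum // mulr0.
Qed.

Lemma interpolation_spectrum (R : realType) (A : fdCstarAlgType R) (a : A)
    (f : R[i] -> R[i]) (z : R[i]) :
  spectrum a z -> (interpolation f (fset_set (spectrum a))).[z] = f z.
Proof. by move=> /fset_spectrumP zs; rewrite interpolationE ?fset_uniq. Qed.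

Lemma fcalcE (R : realType) (A : fdCstarAlgType R) (a : A) (f : R[i] -> R[i])
    (p : {poly R[i]}) :
  star a = a -> (forall z, spectrum a z -> p.[z] = f z) ->
  fcalc f a = horner_alg a p.
Proof.
move=> sa pf; apply: eq_horner_spectrum => // z hz.
by rewrite interpolation_spectrum // pf.
Qed.

Lemma star_fcalc (R : realType) (A : fdCstarAlgType R) (a : A)
    (f : R[i] -> R[i]) :
  star a = a -> (forall z, spectrum a z -> (f z)^* = f z) ->
  star (fcalc f a) = fcalc f a.
Proof.
move=> sa fr; rewrite star_horner sa; apply: eq_horner_spectrum => // z hz.
rewrite -{1}(selfadj_spectrum_real sa hz) horner_map interpolation_spectrum //.
exact: fr.
Qed.

Lemma fcalcM (R : realType) (A : fdCstarAlgType R) (a : A)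
    (f g : R[i] -> R[i]) :
  star a = a -> fcalc f a * fcalc g a = fcalc (fun z => f z * g z) a.
Proof.
move=> sa; rewrite -rmorphM /=; apply: eq_horner_spectrum => // z hz.
by rewrite hornerM !interpolation_spectrum.
Qed.

Lemma spectral_decomposition (R : realType) (A : fdCstarAlgType R) (a : A)
    (p : {poly R[i]}) :
  star a = a ->
  horner_alg a p =
    \sum_(z <- fset_set (spectrum a)) p.[z] *: fcalc (fun w => (w == z)%:R) a.
Proof.
move=> sa; set s := fset_set _.
transitivity (horner_alg a
  (\sum_(z <- s) p.[z]%:P * interpolation (fun w => (w == z)%:R) s)).
  apply: eq_horner_spectrum => // w hw.
  have /fset_spectrumP ws := hw.
  rewrite horner_sum (bigD1_seq w) ?fset_uniq //= big1 => [|z zw].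
    by rewrite hornerM hornerC interpolation_spectrum // eqxx mulr1 addr0.
  by rewrite hornerM hornerC interpolation_spectrum // eq_sym (negbTE zw) mulr0.
rewrite rmorph_sum; apply: eq_bigr => z _.
by rewrite rmorphM /= horner_algC -scalerAl mul1r.
Qed.

(** * The trace of left multiplication *)

Definition regular_trace (K : fieldType) (A : falgType K) (a : A) : K :=
  \tr (f2mx (amull a)).

Lemma v2r_mull (K : fieldType) (A : falgType K) (a w : A) :
  v2r (a * w) = v2r w *m f2mx (amull a).
Proof.
have : amull a w = a * w by rewrite lfunE.
by rewrite unlock /= => /(congr1 v2r); rewrite r2vK.
Qed.

(** Matrices act on row vectors from the right, which reverses the order of composition. *)
Lemma f2mx_amullM (K : fieldType) (A : falgType K) (a b : A) :
  f2mx (amull (a * b)) = f2mx (amull b) *m f2mx (amull a).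
Proof.
apply/row_matrixP => i; rewrite !rowE mulmxA -[delta_mx _ _]r2vK.
by rewrite -!v2r_mull mulrA.
Qed.

Lemma regular_traceC (K : fieldType) (A : falgType K) (a b : A) :
  regular_trace (a * b) = regular_trace (b * a).
Proof. by rewrite /regular_trace !f2mx_amullM mxtrace_mulC. Qed.

Lemma f2mx_amull_linear (K : fieldType) (A : falgType K) (c : K) (a b : A) :
  f2mx (amull (c *: a + b)) = c *: f2mx (amull a) + f2mx (amull b).
Proof.
apply/row_matrixP => i; rewrite !rowE -[delta_mx _ _]r2vK mulmxDr -scalemxAr.
by rewrite -!v2r_mull mulrDl -scalerAl linearP.
Qed.

Lemma regular_trace_linear (K : fieldType) (A : falgType K) (c : K) (a b : A) :
  regular_trace (c *: a + b) = c * regular_trace a + regular_trace b.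
Proof. by rewrite /regular_trace f2mx_amull_linear mxtraceD mxtraceZ. Qed.

Lemma regular_traceD (K : fieldType) (A : falgType K) (a b : A) :
  regular_trace (a + b) = regular_trace a + regular_trace b.
Proof. by rewrite -[a in LHS]scale1r regular_trace_linear mul1r. Qed.

Lemma regular_trace0 (K : fieldType) (A : falgType K) :
  regular_trace (0 : A) = 0.
Proof. by apply: (addrI (regular_trace (0 : A))); rewrite -regular_traceD !addr0. Qed.

Lemma regular_traceZ (K : fieldType) (A : falgType K) (c : K) (a : A) :
  regular_trace (c *: a) = c * regular_trace a.
Proof. by rewrite -[c *: a]addr0 regular_trace_linear regular_trace0 addr0. Qed.

Lemma regular_traceB (K : fieldType) (A : falgType K) (a b : A) :
  regular_trace (a - b) = regular_trace a - regular_trace b.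
Proof. by rewrite regular_traceD -scaleN1r regular_traceZ mulN1r. Qed.

Lemma regular_trace_sum (K : fieldType) (A : falgType K) (I : Type)
    (r : seq I) (F : I -> A) :
  regular_trace (\sum_(i <- r) F i) = \sum_(i <- r) regular_trace (F i).
Proof.
by elim/big_rec2: _ => [|i s b _ <-]; rewrite ?regular_trace0 ?regular_traceD.
Qed.

(** In the full rank factorization of [M], idempotence makes the product of the two factors in the
    opposite order the identity of size [\rank M], and the trace does not see that order. *)
Lemma mxtrace_idem (K : fieldType) (n : nat) (M : 'M[K]_n) :
  M *m M = M -> \tr M = (\rank M)%:R.
Proof.
move=> MM; rewrite -{1}(mulmx_base M) mxtrace_mulC.
suff -> : row_base M *m col_base M = 1%:M by rewrite mxtrace1.
apply: (row_full_inj (col_base_full M)); apply: (row_free_inj (row_base_free M)).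
by rewrite mulmx1 mulmx_base -mulmxA -mulmxA mulmx_base mulmxA mulmx_base.
Qed.

Lemma regular_trace_idem (K : fieldType) (A : falgType K) (e : A) :
  e * e = e -> e = 0 \/ exists n, regular_trace e = n.+1%:R.
Proof.
move=> ee; rewrite /regular_trace mxtrace_idem -?f2mx_amullM ?ee //.
case h : (\rank _) => [|n]; last by right; exists n.
left; move/eqP: h; rewrite mxrank_eq0 => /eqP h.
by rewrite -[e]mulr1; apply: (can_inj v2rK); rewrite v2r_mull h mulmx0 linear0.
Qed.

(** * Positivity of the trace *)

Lemma spectral_idem (R : realType) (A : fdCstarAlgType R) (a : A) (z : R[i]) :
  star a = a -> let e := fcalc (fun w => (w == z)%:R) a in
  star e = e /\ e * e = e.
Proof.
move=> sa; split; first by rewrite star_fcalc // => w _; rewrite conjC_nat.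
rewrite fcalcM //; congr (fcalc _ a); apply/funext => w.
by rewrite -natrM mulnb andbb.
Qed.

(** By the spectral decomposition the trace is a sum of the values [p.[z]] weighted by traces of
    spectral projections. These weights are natural numbers, zero only for a zero projection. *)
Lemma trace_horner_ge0 (R : realType) (A : fdCstarAlgType R) (a : A)
    (p : {poly R[i]}) :
  star a = a -> (forall z, spectrum a z -> 0 <= p.[z]) ->
  0 <= regular_trace (horner_alg a p) ?= iff (horner_alg a p == 0).
Proof.
move=> sa p0; rewrite spectral_decomposition // regular_trace_sum.
set e := fun z => fcalc (fun w => (w == z)%:R) a.
have e0 z : e z = 0 \/ exists n, regular_trace (e z) = n.+1%:R.
  by apply: regular_trace_idem; case: (spectral_idem z sa).
have F0 z : z \in fset_set (spectrum a) -> 0 <= regular_trace (p.[z] *: e z).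
  move=> /fset_spectrumP /p0 pz; rewrite regular_traceZ.
  by have [->|[n ->]] := e0 z; rewrite ?regular_trace0 ?mulr0 // mulr_ge0.
apply/leifP; case: ifPn => [/eqP h|].
  by rewrite -regular_trace_sum h regular_trace0.
move=> H0; rewrite lt_def; apply/andP; split; last by rewrite big_seq sumr_ge0.
apply: contraNneq H0 => /eqP; rewrite big_seq psumr_eq0 //.
move=> /allP h; apply/eqP; rewrite big_seq big1 // => z zs.
have /implyP/(_ zs) := h z zs; rewrite regular_traceZ -/(e z).
have [->|[n ->]] := e0 z; first by rewrite scaler0.
by rewrite mulf_eq0 pnatr_eq0 orbF => /eqP ->; rewrite scale0r.
Qed.

Lemma trace_sqr_ge0 (R : realType) (A : fdCstarAlgType R) (a : A) :
  star a = a -> 0 <= regular_trace (a * a) ?= iff (a == 0).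
Proof.
move=> sa; have -> : a * a = horner_alg a ('X * 'X).
  by rewrite rmorphM /= horner_algX.
have -> : (a == 0) = (horner_alg a ('X * 'X) == 0).
  rewrite rmorphM /= horner_algX; apply/eqP/eqP => [->|h]; first by rewrite mul0r.
  by apply: star_mul_eq0; rewrite sa.
apply: trace_horner_ge0 => // z /(selfadj_spectrum_real sa) zr.
by rewrite hornerM hornerX -{1}zr mulrC mul_conjC_ge0.
Qed.

(* [a + a^*] and [i (a^* - a)] are self-adjoint, the sum of their squares is
   [2 (a a^* + a^* a)], and the trace does not see the order of the factors. *)
Lemma trace_star_mul_ge0 (R : realType) (A : fdCstarAlgType R) (a : A) :
  0 <= regular_trace (star a * a) ?= iff (a == 0).
Proof.
pose c := a + star a; pose d := 'i *: (star a - a).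
have sc : star c = c by rewrite /c starD starK addrC.
have sd : star d = d.
  by rewrite /d starZ starB starK conjCi scaleNr -scalerN opprB.
have E : regular_trace (c * c) + regular_trace (d * d) =
    regular_trace (star a * a) *+ 4.
  rewrite -regular_traceD.
  pose X := a * star a + star a * a; pose Y := a * a + star a * star a.
  have -> : c * c = X + Y.
    by rewrite mulrDl !mulrDr [a * a + _]addrC addrACA.
  have -> : d * d = X - Y.
    rewrite /d -scalerAl -scalerAr scalerA -expr2 sqrCi scaleN1r mulrBl !mulrBr.
    by rewrite !opprB addrACA -opprD.
  rewrite addrACA subrr addr0 /X.
  by rewrite !regular_traceD (regular_traceC a) -!mulr2n -mulrnA.
apply/leifP; case: ifPn => [/eqP ->|a0]; first by rewrite mulr0 regular_trace0.
have c0 := trace_sqr_ge0 sc; have d0 := trace_sqr_ge0 sd.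
rewrite -(pmulrn_lgt0 _ (ltn0Sn 3)) -E lt_def addr_ge0 ?c0 ?d0 // andbT.
rewrite paddr_eq0 ?c0 ?d0 // ![regular_trace _ == 0]eq_sym c0 d0; apply: contra a0.
rewrite /d scaler_eq0 (negbTE (neq0Ci _)) /= subr_eq0 => /andP[ca /eqP sa].
by move: ca; rewrite /c sa -mulr2n -scaler_nat scaler_eq0 pnatr_eq0.
Qed.

(** * A common threshold for finitely many conditions *)

Lemma exists_uniform_small (R : realFieldType) (T : eqType) (l : seq T)
    (P : T -> R -> Prop) :
  (forall t, t \in l -> exists2 d0, 0 < d0 & forall d, 0 < d <= d0 -> P t d) ->
  exists2 d0, 0 < d0 & forall d, 0 < d <= d0 -> forall t, t \in l -> P t d.
Proof.
elim: l => [|t l IH] h; first by exists 1.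
have [d1 d1p h1] := h t (mem_head _ _).
have [d2 d2p h2] := IH (fun s sl => h s (mem_behead (s := t :: l) sl)).
exists (Num.min d1 d2) => [|d]; first by rewrite lt_min d1p.
rewrite le_min => /and3P[d0 dd1 dd2] s; rewrite inE => /predU1P[->|sl].
  by apply: h1; rewrite d0.
by apply: h2; rewrite ?d0.
Qed.

(** * The Hilbert space norm defined by the trace *)

Lemma star_mul_mul (R : realType) (A : fdCstarAlgType R) (a w : A) :
  star (a * w) * (a * w) = star w * (star a * a * w).
Proof. by rewrite starM !mulrA. Qed.

(** With [h] the square root of [p] at [a], the trace is that of [star (h * w) * (h * w)]. Thus an
    inequality on the spectrum becomes an operator inequality on the Hilbert space. *)
Lemma trace_conj_ge0 (R : realType) (A : fdCstarAlgType R) (a w : A)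
    (p : {poly R[i]}) :
  star a = a -> (forall z, spectrum a z -> 0 <= p.[z]) ->
  0 <= regular_trace (star w * (horner_alg a p * w)).
Proof.
move=> sa p0; pose h := fcalc (fun z => sqrtC p.[z]) a.
have sh : star h = h.
  by rewrite star_fcalc // => z /p0 pz; rewrite geC0_conj // sqrtC_ge0.
have -> : horner_alg a p = star h * h.
  rewrite sh fcalcM //; apply/esym/fcalcE => // z _.
  by rewrite -expr2 sqrtCK.
by rewrite -star_mul_mul trace_star_mul_ge0.
Qed.

(* The square of the Hilbert-Schmidt norm of left multiplication by [a]. *)
Definition hs_sqnorm (R : realType) (A : fdCstarAlgType R) (a : A) : R :=
  complex.Re (regular_trace (star a * a)).

Lemma hs_sqnormE (R : realType) (A : fdCstarAlgType R) (a : A) :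
  regular_trace (star a * a) = (hs_sqnorm a)%:C.
Proof.
rewrite /hs_sqnorm; have [] := trace_star_mul_ge0 a.
by case: (regular_trace _) => p q; rewrite lecE /= => /andP[/eqP ->].
Qed.

Lemma hs_sqnorm_gt0 (R : realType) (A : fdCstarAlgType R) (a : A) :
  a != 0 -> 0 < hs_sqnorm a.
Proof.
move=> a0; have [h1 h2] := trace_star_mul_ge0 a.
have : 0 < regular_trace (star a * a) by rewrite lt_def eq_sym h2 a0.
by rewrite hs_sqnormE ltcR.
Qed.

Lemma hs_sqnorm_parallelogram (R : realType) (A : fdCstarAlgType R) (a b : A) :
  hs_sqnorm (a + b) + hs_sqnorm (a - b) = 2 * (hs_sqnorm a + hs_sqnorm b).
Proof.
apply: (@complexI R); rewrite mulr_natl mulr2n !rmorphD /=.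
rewrite -!hs_sqnormE -!regular_traceD.
pose X := star a * a + star b * b; pose Y := star a * b + star b * a.
have -> : star (a + b) * (a + b) = X + Y.
  by rewrite starD mulrDl !mulrDr [star b * a + _]addrC addrACA.
have -> : star (a - b) * (a - b) = X - Y.
  rewrite starB mulrBl !mulrBr opprB addrACA; congr (_ + _).
  by rewrite opprD.
rewrite addrACA subrr addr0.
by rewrite regular_traceD.
Qed.

Lemma hs_sqnorm_unitary (R : realType) (A : fdCstarAlgType R) (u a : A) :
  unitary u -> hs_sqnorm (u * a) = hs_sqnorm a.
Proof.
move=> [uu _]; congr complex.Re; congr regular_trace.
by rewrite star_mul_mul uu mul1r.
Qed.

Lemma unitary_star (R : realType) (A : fdCstarAlgType R) (u : A) :
  unitary u -> unitary (star u).
Proof. by case=> uu uU; split; rewrite starK. Qed.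

(** * Spectra of [star y * y] and of the absolute value *)

Lemma spectrum_norm_le (R : realType) (A : fdCstarAlgType R) (a : A) (z : R[i]) :
  spectrum a z -> `|z| <= (cnorm a)%:C.
Proof.
move=> /spectrumP[w w0 aw]; rewrite lecR.
have wp : 0 < cnorm w.
  rewrite lt_def cnorm_ge0 andbT; apply: contraNneq w0 => /cnorm0_eq0 ->.
  exact: eqxx.
by rewrite -(ler_pM2r wp) -cnormZ -aw cnormM_le.
Qed.

(** For an eigenvector [w], [z] times the positive trace of [star w * w] is the trace of
    [star (y * w) * (y * w)]. *)
Lemma spectrum_star_mul_ge0 (R : realType) (A : fdCstarAlgType R) (y : A)
    (z : R[i]) :
  spectrum (star y * y) z -> 0 <= z.
Proof.
move=> /spectrumP[w w0 yw].
have [h _] := trace_star_mul_ge0 (y * w).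
move: h; rewrite star_mul_mul yw -scalerAr regular_traceZ.
by rewrite hs_sqnormE pmulr_lge0 // ltcR hs_sqnorm_gt0.
Qed.

Lemma star_star_mul (R : realType) (A : fdCstarAlgType R) (y : A) :
  star (star y * y) = star y * y.
Proof. by rewrite starM starK. Qed.

Lemma star_absolute (R : realType) (A : fdCstarAlgType R) (y : A) :
  star (absolute y) = absolute y.
Proof.
rewrite star_fcalc // ?star_star_mul // => z /spectrum_star_mul_ge0 z0.
by rewrite geC0_conj // sqrtC_ge0.
Qed.

Lemma absolute_sqr (R : realType) (A : fdCstarAlgType R) (y : A) :
  absolute y * absolute y = star y * y.
Proof.
rewrite /absolute fcalcM ?star_star_mul // -[RHS](horner_algX (star y * y)).
by apply: fcalcE; rewrite ?star_star_mul // => z _; rewrite hornerX -expr2 sqrtCK.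
Qed.

Lemma spectrum_absolute_ge0 (R : realType) (A : fdCstarAlgType R) (y : A)
    (z : R[i]) :
  spectrum (absolute y) z -> 0 <= z.
Proof.
move=> /spectrumP[w w0 yw].
have : 0 <= regular_trace (star w * (absolute y * w)).
  apply: trace_conj_ge0 => [|t ht]; first exact: star_star_mul.
  by rewrite interpolation_spectrum // sqrtC_ge0 (spectrum_star_mul_ge0 ht).
by rewrite yw -scalerAr regular_traceZ hs_sqnormE pmulr_lge0 // ltcR hs_sqnorm_gt0.
Qed.

Lemma spectrum_absoluteP (R : realType) (A : fdCstarAlgType R) (y : A) (z : R[i]) :
  spectrum (absolute y) z -> exists t, [/\ z = t%:C, t \in singvals y & 0 <= t].
Proof.
move=> hz; have := spectrum_absolute_ge0 hz.
case: z hz => s q hz; rewrite lecE /= => /andP[/eqP q0 s0].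
exists s; rewrite mem_singvals; split => //; first by rewrite q0.
by move: hz; rewrite q0 => ?; rewrite inE.
Qed.

(** * Perturbation of singular values *)

(** The spectrum of [star a * a] is bounded by its norm, which is [cnorm a ^+ 2]; so left
    multiplication by [a] has Hilbert space norm at most [cnorm a]. *)
Lemma hs_sqnorm_mul_le (R : realType) (A : fdCstarAlgType R) (a w : A) :
  hs_sqnorm (a * w) <= cnorm a ^+ 2 * hs_sqnorm w.
Proof.
have : 0 <= regular_trace
    (star w * (horner_alg (star a * a) ((cnorm a ^+ 2)%:C%:P - 'X) * w)).
  apply: trace_conj_ge0 => [|z hz]; first exact: star_star_mul.
  rewrite hornerD hornerN hornerC hornerX subr_ge0 -cnorm_star.
  by rewrite -[z]ger0_norm ?spectrum_norm_le // (spectrum_star_mul_ge0 hz).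
rewrite rmorphB /= horner_algX horner_algC mulrBl mulrBr -scalerAl mul1r -scalerAr.
rewrite -star_mul_mul regular_traceB !regular_traceZ !hs_sqnormE.
by rewrite subr_ge0 -rmorphM /= lecR.
Qed.

(** A self-adjoint element has no approximate eigenvector for a number far from its spectrum. *)
Lemma hs_sqnorm_ge (R : realType) (A : fdCstarAlgType R) (a w : A) (s k : R) :
  star a = a -> (forall z, spectrum a z -> k%:C <= (z - s%:C) ^+ 2) ->
  k * hs_sqnorm w <= hs_sqnorm (a * w - s%:C *: w).
Proof.
move=> sa ks; pose b := a - s%:C%:A.
have sb : star b = b.
  by rewrite /b starB starZ star1 sa; congr (_ - _ *: _); exact: conjc_real.
have : 0 <= regular_trace
    (star w * (horner_alg a (('X - s%:C%:P) ^+ 2 - k%:C%:P) * w)).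
  apply: trace_conj_ge0 => // z hz.
  by rewrite hornerD hornerN hornerC horner_exp hornerXsubC subr_ge0 ks.
rewrite rmorphB rmorphXn rmorphB /= horner_algX !horner_algC -/b mulrBl mulrBr.
rewrite -scalerAl mul1r -scalerAr expr2 -{1}sb -star_mul_mul.
have -> : b * w = a * w - s%:C *: w by rewrite /b mulrBl -scalerAl mul1r.
rewrite regular_traceB !regular_traceZ !hs_sqnormE.
by rewrite subr_ge0 -rmorphM /= lecR.
Qed.

(* A singular vector [w] of [y] for [s] gives approximate eigenvectors
   [w + u^* v w] and [w - u^* v w] of [|x|] for [s] and [- s]; adding the two
   estimates by the parallelogram law gives the constant 1. *)
Lemma singvals_perturbation (R : realType) (A : fdCstarAlgType R)
    (x u y v : A) (s : R) :
  unitary u -> x = u * absolute x -> unitary v -> y = v * absolute y ->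
  s \in singvals y -> exists2 t, t \in singvals x & `|s - t| <= cnorm (y - x).
Proof.
move=> uu hx uv hy sy; apply: contrapT => hn.
set r := y - x in hn *.
have hlt t : t \in singvals x -> cnorm r ^+ 2 < (s - t) ^+ 2.
  move=> tx; rewrite -[ltRHS]real_normK ?num_real // ltr_pXn2r ?nnegrE ?cnorm_ge0 //.
  by rewrite ltNge; apply/negP => h; apply: hn; exists t.
(* There are finitely many singular values of [x], so the strict inequalities share a margin [e],
   which yields the final contradiction. *)
have [e e0 he] : exists2 e : R, 0 < e & forall d, 0 < d <= e -> forall t,
    t \in singvals x -> cnorm r ^+ 2 + d <= (s - t) ^+ 2.
  apply: exists_uniform_small => t /hlt h.
  exists ((s - t) ^+ 2 - cnorm r ^+ 2); first by rewrite subr_gt0.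
  by move=> d /andP[_ hd]; lra.
have {}he := he e; rewrite e0 lexx in he; have {}he := he isT.
have sy' : spectrum (absolute y) s%:C by move: sy; rewrite mem_singvals inE.
have s0 : 0 <= s by rewrite -ler0c (spectrum_absolute_ge0 sy').
move/spectrumP: sy' => [w w0 Qw].
set P := absolute x in hx; set k := cnorm r ^+ 2 + e in he.
(* Up to the errors [g1] and [g2], [P] sends [w] to [s] times [b] and [b] to [s] times [w]. *)
pose b := star u * (v * w).
pose g1 := star u * (r * w); pose g2 := star r * (v * w).
have Pw : P * w = s%:C *: b - g1.
  have -> : P * w = star u * (x * w).
    by rewrite hx !mulrA (proj1 uu) mul1r.
  rewrite /g1 /b scalerAr -mulrBr; congr (_ * _).
  by rewrite /r mulrBl {1}hy -mulrA Qw -scalerAr subKr.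
have Pb : P * b = s%:C *: w - g2.
  have -> : P * b = star x * (v * w).
    by rewrite hx starM star_absolute /b mulrA.
  rewrite /g2 /r starB mulrBl {1}hy starM star_absolute -!mulrA (mulrA (star v)).
  by rewrite (proj1 uv) mul1r Qw subKr.
have nb : hs_sqnorm b = hs_sqnorm w.
  by rewrite /b !hs_sqnorm_unitary //; exact: unitary_star.
(* The bound carries over to [- s] because [s] and [t] are nonnegative, so [t + s] is at least the
   distance of [s] and [t]. *)
have spec_ge (s' : R) : s' = s \/ s' = - s ->
    forall z, spectrum P z -> k%:C <= (z - s'%:C) ^+ 2.
  move=> hs z /spectrum_absoluteP[t [-> tx t0]].
  rewrite -rmorphB -rmorphXn /= lecR; apply: (le_trans (he _ tx)).
  by case: hs => ->; nra.
have h1 := hs_sqnorm_ge (w + b) (star_absolute x) (spec_ge s (or_introl erefl)).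
have h2 := hs_sqnorm_ge (w - b) (star_absolute x) (spec_ge (- s) (or_intror erefl)).
have E1 : P * (w + b) - s%:C *: (w + b) = - (g2 + g1).
  rewrite mulrDr Pw Pb addrACA [_ + s%:C *: w]addrC -scalerDr addrAC subrr add0r.
  by rewrite -opprD addrC.
have E2 : P * (w - b) - (- s)%:C *: (w - b) = g2 - g1.
  have -> : (- s)%:C = - s%:C by exact: rmorphN.
  rewrite mulrBr Pw Pb scaleNr opprK scalerBr opprB [s%:C *: b - g1]addrC.
  by rewrite !addrA subrK addrAC addrK addrC.
rewrite -/P E1 in h1; rewrite -/P E2 in h2.
have nN (c : A) : hs_sqnorm (- c) = hs_sqnorm c.
  by rewrite /hs_sqnorm starN mulrNN.
rewrite nN in h1.
have p1 := hs_sqnorm_parallelogram w b; have p2 := hs_sqnorm_parallelogram g2 g1.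
have q1 : hs_sqnorm g1 <= cnorm r ^+ 2 * hs_sqnorm w.
  by rewrite /g1 hs_sqnorm_unitary ?hs_sqnorm_mul_le //; exact: unitary_star.
have q2 : hs_sqnorm g2 <= cnorm r ^+ 2 * hs_sqnorm w.
  by rewrite -(hs_sqnorm_unitary w uv) -(cnorm_starE r) hs_sqnorm_mul_le.
have wp := hs_sqnorm_gt0 w0.
rewrite /k in h1 h2; rewrite nb in p1.
(* The scaled parallelogram identity keeps the problem linear. With N the squared norm of [w],
   adding [h1] and [h2] gives 4 ([cnorm r ^+ 2 + e]) N at most 4 [cnorm r ^+ 2] N. *)
have := congr1 (fun t => (cnorm r ^+ 2 + e) * t) p1.
have := mulr_gt0 e0 wp; lra.
Qed.

(** * Norm and Lipschitz estimates for polynomials *)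

Lemma size_spectrum_le (R : realType) (A : fdCstarAlgType R) (a : A) :
  (size (fset_set (spectrum a)) <= \dim {:A})%N.
Proof.
have [p [p0 sp pa]] := annihilating_poly a.
rewrite -ltnS (leq_trans _ sp) // max_poly_roots ?fset_uniq //.
apply/allP => z /fset_spectrumP /spectrumP[w w0 /horner_alg_eigen h].
move: (h p); rewrite pa mul0r => /esym/eqP.
by rewrite scaler_eq0 (negbTE w0) orbF.
Qed.

(** Triangle inequality over the spectral decomposition, whose projections have norm at most 1. The
    dimension bounds the number of terms independently of [a]. *)
Lemma cnorm_horner_le (R : realType) (A : fdCstarAlgType R) (a : A)
    (p : {poly R[i]}) (B : R) :
  star a = a -> (forall z, spectrum a z -> `|p.[z]| <= B%:C) -> 0 <= B ->
  cnorm (horner_alg a p) <= (\dim {:A})%:R * B.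
Proof.
move=> sa hB B0; rewrite spectral_decomposition //.
apply: le_trans (cnorm_sum_le _ _) _.
apply: (@le_trans _ _ (\sum_(z <- fset_set (spectrum a)) B)); last first.
  rewrite big_const_seq count_predT iter_addr addr0 -[B *+ _]mulr_natl.
  by rewrite ler_wpM2r // ler_nat size_spectrum_le.
rewrite big_seq [leRHS]big_seq ler_sum // => z /fset_spectrumP zs.
rewrite cnormZ -[B]mulr1 ler_pM ?cnorm_ge0 //.
- by rewrite -[leRHS]mulr1 -(cnorm1 A) -cnormZ cnorm_ge0.
- by rewrite -lecR; exact: hB.
- by have [] := spectral_idem z sa; exact: cnorm_idem_le1.
Qed.

(** Induction on [p], carrying a bound [D] for [p] at [a]: the difference of p(a) a and p(b) b is
    (p(a) - p(b)) a + p(b) (a - b). *)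
Lemma horner_alg_lipschitz (R : realType) (A : fdCstarAlgType R) (M : R)
    (p : {poly R[i]}) :
  exists2 C, 0 <= C & forall a b : A, cnorm a <= M -> cnorm b <= M ->
    cnorm (horner_alg a p - horner_alg b p) <= C * cnorm (a - b).
Proof.
have [M0|M0] := ltP M 0.
  exists 0 => // a b aM; have := cnorm_ge0 a; lra.
suff [C [C0 [D [D0 h]]]] : exists C : R, 0 <= C /\ exists D : R, 0 <= D /\
  forall a b : A, cnorm a <= M -> cnorm b <= M ->
    cnorm (horner_alg a p - horner_alg b p) <= C * cnorm (a - b) /\
    cnorm (horner_alg a p) <= D.
  by exists C => // a b aM bM; case: (h a b aM bM).
elim/poly_ind: p => [|p c [C [C0 [D [D0 h]]]]].
  exists 0; split => //; exists 0; split => // a b _ _.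
  by rewrite !rmorph0 subrr cnorm0 mul0r.
exists (C * M + D); split; first by rewrite addr_ge0 // mulr_ge0.
exists (D * M + ComplexField.Normc.normc c); split.
  rewrite addr_ge0 ?mulr_ge0 // -[ComplexField.Normc.normc c]mulr1.
  by rewrite -(cnorm1 A) -cnormZ cnorm_ge0.
move=> a b aM bM; have [h1 h2] := h a b aM bM; have [_ h3] := h b a bM aM.
rewrite !rmorphD !rmorphM /= !horner_algX !horner_algC; split; last first.
  apply: le_trans (cnormD_le _ _) _; rewrite cnormZ cnorm1 mulr1 lerD2r.
  by apply: le_trans (cnormM_le _ _) _; rewrite ler_pM ?cnorm_ge0.
have -> : horner_alg a p * a + c%:A - (horner_alg b p * b + c%:A) =
    (horner_alg a p - horner_alg b p) * a + horner_alg b p * (a - b).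
  by rewrite opprD addrACA subrr addr0 mulrBl mulrBr addrA subrK.
apply: le_trans (cnormD_le _ _) _; rewrite [leRHS]mulrDl lerD //.
  apply: le_trans (cnormM_le _ _) _; rewrite mulrAC.
  by rewrite ler_pM ?cnorm_ge0.
apply: le_trans (cnormM_le _ _) _.
by rewrite ler_pM ?cnorm_ge0.
Qed.

Lemma horner_alg_comp (K : fieldType) (A : algType K) (a : A) (p q : {poly K}) :
  horner_alg a (p \Po q) = horner_alg (horner_alg a q) p.
Proof.
elim/poly_ind: p => [|p c IH]; first by rewrite comp_poly0 !rmorph0.
by rewrite comp_polyD comp_polyM comp_polyX comp_polyC !rmorphD !rmorphM /= IH
  !horner_algC horner_algX.
Qed.

Lemma normc_real (R : realType) (s : R) : ComplexField.Normc.normc s%:C = `|s|.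
Proof. by rewrite /ComplexField.Normc.normc /= expr0n addr0 sqrtr_sqr. Qed.

(** The previous estimate at scalar multiples of the unit. *)
Lemma horner_lipschitz (R : realType) (A : fdCstarAlgType R) (M : R)
    (p : {poly R[i]}) :
  exists2 C, 0 <= C & forall s t : R, `|s| <= M -> `|t| <= M ->
    `|p.[s%:C] - p.[t%:C]| <= (C * `|s - t|)%:C.
Proof.
have cnormA (z : R[i]) : cnorm (z%:A : A) = ComplexField.Normc.normc z.
  by rewrite cnormZ cnorm1 mulr1.
have hornerA (z : R[i]) : horner_alg (z%:A : A) p = p.[z]%:A.
  by rewrite -[LHS]mulr1; apply: horner_alg_eigen; rewrite mulr1.
have [C C0 h] := horner_alg_lipschitz A M p; exists C => // s t sM tM.
have := h s%:C%:A t%:C%:A; rewrite !hornerA -!scalerBl !cnormA !normc_real.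
have -> : s%:C - t%:C = (s - t)%:C by rewrite rmorphB.
by rewrite normc_real lecR; apply.
Qed.

(** * Continuity of the partial isometries *)

Lemma singvals_ge0 (R : realType) (A : fdCstarAlgType R) (x : A) (t : R) :
  t \in singvals x -> 0 <= t.
Proof. by rewrite mem_singvals inE => /spectrum_absolute_ge0; rewrite ler0c. Qed.

Lemma singvals_norm_le (R : realType) (A : fdCstarAlgType R) (x : A) (t : R) :
  t \in singvals x -> `|t| <= cnorm (absolute x).
Proof.
by rewrite mem_singvals inE => /spectrum_norm_le; rewrite lecR normc_real.
Qed.

Lemma indic_real_complex (R : realType) (S : set R) (t : R) :
  \1_(real_complex R @` S) t%:C = (\1_S t : R[i]).
Proof.
rewrite !indicE; congr (_ %:R); congr nat_of_bool; apply/idP/idP; rewrite !inE.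
  by move=> [s Ss [<-]].
by exists t.
Qed.

(* With [k] the odd polynomial [X g(X^2)] that takes the value 1 at [s] and 0 at
   the other singular values of [x], the partial isometry of [x] is
   [u k(|x|) = x g(x^* x)], and that of [y] is close to [v k(|y|) = y g(y^* y)]
   because [k(|y|)] is close to the spectral projection of [|y|]. *)
Lemma partial_isometry_continuity (R : realType) (A : fdCstarAlgType R)
    (x u : A) (eps s : R) :
  unitary u -> x = u * absolute x -> 0 < eps -> s \in singvals x -> 0 < s ->
  exists2 d0 : R, 0 < d0 & forall d, 0 < d <= d0 -> below_half_gap x d ->
    forall y v : A, cnorm (y - x) <= d -> unitary v -> y = v * absolute y ->
    cnorm (u * spectral_proj (absolute x) [set s] -
           v * spectral_proj (absolute y) `[s - d, s + d]) <= eps.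
Proof.
move=> uu hx eps0 sx s0.
pose nodes := undup [seq (t ^+ 2)%:C | t <- singvals x].
(* The value [s^-1] cancels the factor ['X] of [k] at [s]. *)
pose g := interpolation (fun z => if z == (s ^+ 2)%:C then (s^-1)%:C else 0) nodes.
pose k := 'X * (g \Po 'X^2).
have hk t : t \in singvals x -> k.[t%:C] = (t == s)%:R.
  move=> tx; have tn : (t ^+ 2)%:C \in nodes.
    by rewrite mem_undup; apply/mapP; exists t.
  rewrite hornerM hornerX horner_comp hornerXn -rmorphXn /=.
  rewrite interpolationE ?undup_uniq //.
  rewrite (inj_eq (@complexI R)) (eqrXn2 (ltn0Sn 1) (singvals_ge0 tx) (ltW s0)).
  case: eqP => [->|_]; last by rewrite mulr0.
  by rewrite -rmorphM /= divff // gt_eqF.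
have hpolar (y v : A) : y = v * absolute y ->
    v * horner_alg (absolute y) k = y * horner_alg (star y * y) g.
  move=> hy; rewrite rmorphM /= horner_alg_comp rmorphXn /= horner_algX expr2.
  by rewrite absolute_sqr mulrA -hy.
have ex : spectral_proj (absolute x) [set s] = horner_alg (absolute x) k.
  apply: fcalcE; first exact: star_absolute.
  move=> z /spectrum_absoluteP[r [-> rx _]].
  rewrite indic_real_complex hk // indicE; congr (_ %:R); congr nat_of_bool.
  by apply/eqP/idP; rewrite inE.
(* Since [d] will be at most 1, [M] bounds the norms of both [x] and [y]. *)
pose M := cnorm x + 1.
have M1 : 1 <= M by rewrite lerDr cnorm_ge0.
have [C C0 hC] := horner_alg_lipschitz A (M * M) g.
have [C' C'0 hC'] := horner_lipschitz A (cnorm (absolute x) + 1) k.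
pose G := horner_alg (star x * x) g; pose n : R := (\dim {:A})%:R.
(* The three summands of [L] bound, per unit of [d], the three error terms [b1], [b2] and [b3]
   below. *)
pose L := cnorm G + M * (C * (M + M)) + n * C'.
have L0 : 0 <= L.
  have M0 : 0 <= M := le_trans ler01 M1.
  have MC0 : 0 <= M * (C * (M + M)) by rewrite mulr_ge0 ?(mulr_ge0 C0) ?(addr_ge0 M0).
  by apply: addr_ge0; [rewrite addr_ge0 ?cnorm_ge0 | rewrite mulr_ge0 ?ler0n].
exists (Num.min 1 (eps / (L + 1))).
  by rewrite lt_min ltr01 divr_gt0 // ltr_pwDr.
move=> d /andP[d0]; rewrite le_min => /andP[d1 dL] gap y v yx uv hy.
have xM : cnorm x <= M by rewrite lerDl.
have yM : cnorm y <= M.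
  rewrite -[y](subrK x) (le_trans (cnormD_le _ _)) // addrC lerD2l.
  exact: le_trans yx d1.
pose G' := horner_alg (star y * y) g.
have GG' : cnorm (G - G') <= C * ((M + M) * d).
  have sM (a : A) : cnorm a <= M -> cnorm (star a * a) <= M * M.
    by move=> aM; rewrite (le_trans (cnormM_le _ _)) // cnorm_starE ler_pM ?cnorm_ge0.
  apply: le_trans (hC _ _ (sM _ xM) (sM _ yM)) _; rewrite ler_wpM2l //.
  have -> : star x * x - star y * y = star x * (x - y) + star (x - y) * y.
    by rewrite starB mulrBl mulrBr addrA subrK.
  have yx' : cnorm (x - y) <= d by rewrite -cnormN opprB.
  rewrite (le_trans (cnormD_le _ _)) // mulrDl lerD //;
    rewrite (le_trans (cnormM_le _ _)) // cnorm_starE.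
    by rewrite ler_pM ?cnorm_ge0.
  by rewrite mulrC ler_pM ?cnorm_ge0.
have qk : cnorm (horner_alg (absolute y) k -
    spectral_proj (absolute y) `[s - d, s + d]) <= n * (C' * d).
  rewrite -rmorphB /=; apply: cnorm_horner_le; first exact: star_absolute.
    move=> z hz; have [t [zt ty t0]] := spectrum_absoluteP hz.
    rewrite hornerD hornerN interpolation_spectrum // {hz}zt indic_real_complex.
    have [r rx rt] := singvals_perturbation uu hx uv hy ty.
    have {}rt : `|t - r| <= d := le_trans rt yx.
    (* If [t] lies in the interval, its neighbour [r] is within [2 * d] of [s], so the gap condition
       forces [r = s]. *)
    have -> : \1_`[s - d, s + d] t = k.[r%:C] :> R[i].
      rewrite hk // indicE; congr (_ %:R); congr nat_of_bool.
      have := rt; rewrite ler_norml => /andP[rt1 rt2].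
      apply/idP/eqP; rewrite inE /= in_itv /=; last first.
        by move=> <-; apply/andP; split; lra.
      move=> /andP[h1 h2]; apply/eqP; apply: contraT => rs.
      have := gap r s; rewrite !inE rx sx !orbT => /(_ isT isT rs).
      by case: (ler0P (r - s)) => _; lra.
    have rP := singvals_norm_le rx.
    apply: le_trans (hC' _ _ _ _) _.
    - rewrite -[t](subrK r) (le_trans (ler_normD _ _)) // addrC lerD //.
      exact: le_trans rt d1.
    - by rewrite (le_trans rP) // lerDl.
    - by rewrite lecR ler_wpM2l.
  by rewrite mulr_ge0 // ltW.
(* The sum telescopes, because [v] times [k] at [absolute y] is [y * G']. *)
have -> : u * spectral_proj (absolute x) [set s] -
    v * spectral_proj (absolute y) `[s - d, s + d] =
    (x - y) * G + y * (G - G') + v * (horner_alg (absolute y) k -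
      spectral_proj (absolute y) `[s - d, s + d]).
  rewrite [v * (_ - _)]mulrBr hpolar // ex hpolar // -/G -/G' addrA; congr (_ - _).
  by rewrite mulrBl mulrBr addrA !subrK.
have b1 : cnorm ((x - y) * G) <= d * cnorm G.
  by rewrite (le_trans (cnormM_le _ _)) // ler_wpM2r ?cnorm_ge0 // -cnormN opprB.
have b2 : cnorm (y * (G - G')) <= M * (C * ((M + M) * d)).
  by rewrite (le_trans (cnormM_le _ _)) // ler_pM ?cnorm_ge0.
have b3 : cnorm (v * (horner_alg (absolute y) k -
    spectral_proj (absolute y) `[s - d, s + d])) <= n * (C' * d).
  by rewrite (le_trans (cnormM_le _ _)) // cnorm_unitary // mul1r.
apply: (@le_trans _ _ (L * d)).
  rewrite (le_trans (cnormD_le _ _)) // (le_trans (lerD (cnormD_le _ _) (lexx _))) //.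
  by apply: le_trans (lerD (lerD b1 b2) b3) _; rewrite /L; lra.
have : d * (L + 1) <= eps by rewrite -ler_pdivlMr // ltr_pwDr.
by apply: le_trans; rewrite mulrDr mulr1 mulrC lerDl ltW.
Qed.

(** * Choice of delta *)

Lemma below_half_gap_exists (R : realType) (A : fdCstarAlgType R) (x : A) :
  exists2 d0 : R, 0 < d0 & forall d, 0 < d <= d0 -> below_half_gap x d.
Proof.
pose l := 0 :: singvals x.
have [st _|d0 d0p h] := @exists_uniform_small R _ [seq (s, t) | s <- l, t <- l]
    (fun st d => st.1 != st.2 -> d < `|st.1 - st.2| / 2).
  have [->|st0] := eqVneq st.1 st.2; first by exists 1.
  have p : 0 < `|st.1 - st.2| by rewrite normr_gt0 subr_eq0.
  (* A quarter of the distance makes the required inequality strict. *)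
  by exists (`|st.1 - st.2| / 4) => [|d /andP[_ hd] _]; lra.
exists d0 => // d hd s t sl tl; apply: (h d hd (s, t)).
by apply/allpairsP; exists (s, t).
Qed.

Theorem theorem3p6 (R : realType) (A : fdCstarAlgType R) (x u : A)
    (hu : unitary u) (hx : x = u * absolute x) (eps : R) (heps : 0 < eps) :
  exists delta : R,
    [/\ 0 < delta, below_half_gap x delta &
      forall y v : A,
        cnorm (y - x) <= delta -> unitary v -> y = v * absolute y ->
        forall i : nat, (i < size (singvals x))%N -> 0 < (singvals x)`_i ->
          cnorm (partial_isom x u i - perturbed_partial_isom x delta y v i) <= eps].
Proof.
have [d1 d1p h1] := below_half_gap_exists x.
(* The condition [0 < s] is part of the predicate, so a zero singular value accepts any
   threshold. *)
have [s sx|d2 d2p h2] := @exists_uniform_small R _ (singvals x) (fun s d => 0 < s ->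
    below_half_gap x d -> forall y v : A,
    cnorm (y - x) <= d -> unitary v -> y = v * absolute y ->
    cnorm (u * spectral_proj (absolute x) [set s]%classic -
           v * spectral_proj (absolute y) `[s - d, s + d]%classic) <= eps).
  have [s0|s0] := ltP 0 s; last by exists 1 => // d _; lra.
  have [d0 d0p h] := partial_isometry_continuity hu hx heps sx s0.
  by exists d0 => // d /h.
have dp : 0 < Num.min d1 d2 by rewrite lt_min d1p.
have gap : below_half_gap x (Num.min d1 d2) by apply: h1; rewrite dp ge_min lexx.
exists (Num.min d1 d2); split => // y v yx hv hy i isz s0.
by apply: h2 => //; rewrite ?mem_nth // dp ge_min lexx orbT.
Qed.
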